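(* Let $(X,d)$ be a complete metric space with $X$ nonempty, let $T:X\to X$ be a map, and suppose that $T$ is $(a,F)$-contractive for some real $a>0$ and some Wardowski function $F:[0,\infty[\,\to\mathbb{R}\cup\{-\infty\}$, i.e. $$a+F(d(Tx,Ty))\le F(d(x,y))\quad\text{for all } x,y\in X \text{ with } x\ne y.$$ Then $T$ is a globally strong Picard operator (modulo $d$).
   Context: A function $F:[0,\infty[\,\to\mathbb{R}\cup\{-\infty\}$ is a Wardowski function if: (1) $F(t)=-\infty$ if and only if $t=0$; (2) $F$ is strictly increasing: $t<s$ implies $F(t)<F(s)$; (3) $F(t)\to-\infty$ as $t\to 0+$. No continuity of $F$ is assumed. The usual conventions for $-\infty$ apply ($-\infty<r$ and $r+(-\infty)=-\infty$ for every real $r$; $-\infty\le-\infty$). Let $\mathrm{Fix}(T)=\{z\in X: Tz=z\}$. $T$ is a Picard operator (modulo $d$) if, for each $x\in X$, the sequence $(T^nx;n\ge 0)$ is $d$-Cauchy and $d$-convergent (i.e. Cauchy, and convergent to a point of $X$, in the metric $d$). It is a strong Picard operator if it is a Picard operator and, for each $x\in X$, the limit of $(T^nx;n\ge 0)$ belongs to $\mathrm{Fix}(T)$. It is a globally strong Picard operator if it is a strong Picard operator and $\mathrm{Fix}(T)$ has at most one element (hence exactly one element). *)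

(* Defs.v *)
From HB Require Import structures.
From mathcomp Require Import all_boot all_order all_algebra.
From mathcomp Require Import all_classical all_reals all_analysis.

Set Implicit Arguments.
Unset Strict Implicit.
Unset Printing Implicit Defensive.

Import Order.TTheory GRing.Theory Num.Theory.
Import numFieldNormedType.Exports.

Local Open Scope classical_set_scope.
Local Open Scope ring_scope.

(* The library's cvg and complete structures require a pointed type, which
   metricType is not; limits of sequences are therefore existentially bound. *)
Definition complete_metric (R : realType) (X : metricType R) : Prop :=
  forall u : nat -> X, cauchy (u @ \oo) -> exists l : X, u @ \oo --> l.

(* A function [0, +oo[ -> R `|` {-oo} is encoded as a function R -> \bar R of
   which only the values at nonnegative reals are constrained (or used below:
   distances are nonnegative); the first clause excludes the value +oo. *)
Definition Wardowski_function (R : realType) (F : R -> \bar R) : Prop :=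
  [/\ forall t : R, 0 <= t -> F t <> +oo%E,
      forall t : R, 0 <= t -> (F t = -oo%E <-> t = 0),
      forall t s : R, 0 <= t -> t < s -> (F t < F s)%E
    & F t @[t --> 0^'+] --> -oo%E].

Definition aF_contractive (R : realType) (X : metricType R)
    (a : R) (F : R -> \bar R) (T : X -> X) : Prop :=
  forall x y : X, x <> y ->
    (a%:E + F (mdist (T x) (T y)) <= F (mdist x y))%E.

Definition Fix (X : Type) (T : X -> X) : set X := [set z | T z = z].

Definition Picard_operator (R : realType) (X : metricType R) (T : X -> X) : Prop :=
  forall x : X,
    cauchy (iter n T x @[n --> \oo]) /\
    exists z : X, iter n T x @[n --> \oo] --> z.

Definition strong_Picard_operator (R : realType) (X : metricType R)
    (T : X -> X) : Prop :=
  Picard_operator T /\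
  forall x z : X, iter n T x @[n --> \oo] --> z -> Fix T z.

Definition globally_strong_Picard_operator (R : realType) (X : metricType R)
    (T : X -> X) : Prop :=
  strong_Picard_operator T /\ is_subset1 (Fix T).

(* Main.v *)
Require Import Defs.
From mathcomp Require Import all_boot all_order all_algebra.
From mathcomp Require Import all_classical all_reals all_analysis.
From mathcomp Require Import lra.

(** Everything rests on one uniform estimate of Meir-Keeler type: for each
    [eps > 0] there is [delta > 0] such that [d(x,y) < eps + delta] implies
    [d(Tx,Ty) <= eps].  A monotone [F] need not be continuous, but it has a
    right limit [L] at [eps], namely the infimum of [F] over the reals beyond
    [eps].  Since [a > 0], some [t > eps] has [F t < L + a]; if [d(x,y) < t],
    the contraction gives [F (d(Tx,Ty)) <= F (d(x,y)) - a < L], so [d(Tx,Ty)]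
    cannot exceed [eps] ([gauge_Meir_Keeler]).

    Along an orbit, the gauge of the step [d(x_n,x_(n+1))] loses at least [a]
    at each iteration, so the steps fall below any [eps > 0], whose gauge is
    finite ([gauge_small_steps]).  The Meir-Keeler estimate turns small steps
    into a Cauchy orbit ([Meir_Keeler_cauchy]): once the steps are shorter
    than [delta], the ball of radius [eps + delta] about [x_n] traps the rest
    of the orbit.  The same estimate makes [T] nonexpansive, hence continuous,
    so limits of orbits are fixed.  Two distinct fixed points at distance [t]
    would give [a + F t <= F t] with [F t] finite. *)

Import Order.TTheory GRing.Theory Num.Theory.
Import numFieldNormedType.Exports.

Local Open Scope classical_set_scope.
Local Open Scope ring_scope.

(** The conclusion covers all pairs with [d(x,y) < eps + delta], including
    those at distance at most [eps]; this is what makes the condition imply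
    nonexpansiveness. *)
Definition Meir_Keeler {R : realType} {X : metricType R} (T : X -> X) : Prop :=
  forall eps : R, 0 < eps -> exists2 delta : R, 0 < delta &
    forall x y : X, mdist x y < eps + delta -> mdist (T x) (T y) <= eps.

Lemma Meir_Keeler_nonexpansive {R : realType} {X : metricType R} (T : X -> X) :
  Meir_Keeler T -> forall x y : X, mdist (T x) (T y) <= mdist x y.
Proof.
move=> mkT x y; have [->|xy] := eqVneq x y; first by rewrite !mdistxx.
have d_gt0 : 0 < mdist x y by rewrite mdist_gt0.
by have [delta delta0] := mkT _ d_gt0; apply; rewrite ltrDl.
Qed.

(** If [x_(n+k)] is within [eps + delta] of [x_n], then [x_(n+k+1)] is within
    [eps] of [x_(n+1)], hence within [eps + delta] of [x_n] again because the
    step from [x_n] to [x_(n+1)] is shorter than [delta]. *)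
Lemma Meir_Keeler_cauchy {R : realType} {X : metricType R} (T : X -> X) (x : X) :
  Meir_Keeler T ->
  (forall eps : R, 0 < eps -> exists N : nat, forall n : nat, (N <= n)%N ->
    mdist (iter n T x) (iter n.+1 T x) < eps) ->
  cauchy (iter n T x @[n --> \oo]).
Proof.
move=> mkT steps; apply: cauchy_exP => e e0.
have e20 : 0 < e / 2 by rewrite divr_gt0.
have [delta delta0 mk] := mkT _ e20.
(* Shrinking delta to at most e / 2 keeps the trapping ball inside radius e. *)
pose r := Num.min delta (e / 2).
have r0 : 0 < r by rewrite lt_min delta0 e20.
have [N stepsN] := steps _ r0.
exists (iter N T x); exists N => // n /= Nn.
rewrite ballEmdist /=.
suff trap k : mdist (iter N T x) (iter (N + k)%N T x) < e / 2 + r.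
  rewrite -(subnKC Nn); apply: lt_le_trans (trap _) _.
  by rewrite [leRHS]splitr lerD2l ge_min lexx orbT.
elim: k => [|k IHk]; first by rewrite addn0 mdistxx addr_gt0.
rewrite addnS; apply: le_lt_trans (metric_triangle _ (iter N.+1 T x) _) _.
rewrite addrC; apply: ler_ltD; last exact: stepsN.
rewrite !iterS; apply: mk; apply: lt_le_trans IHk _.
by rewrite lerD2l ge_min lexx.
Qed.

Lemma nonexpansive_limit_fixed {R : realType} {X : metricType R} (T : X -> X)
    (x z : X) :
  (forall u v : X, mdist (T u) (T v) <= mdist u v) ->
  iter n T x @[n --> \oo] --> z -> Fix T z.
Proof.
move=> Tne /metricType_numDomainType.cvgrPdist_lt xz.
apply: mdist_positivity; apply/eqP; rewrite eq_le mdist_ge0 andbT.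
apply/ler_addgt0Pl => e e0; rewrite addr0.
have e20 : 0 < e / 2 by rewrite divr_gt0.
have [N _ zN] := xz _ e20.
apply: le_trans (metric_triangle _ (iter N.+1 T x) _) _.
rewrite [leRHS]splitr; apply: lerD.
  by rewrite iterS (le_trans (Tne _ _))// ltW// zN /=.
by rewrite metric_sym ltW// zN /=.
Qed.

(** Real-valued form of an [(a,F)]-contraction: only positive distances
    matter, and there a Wardowski function is finite. *)
Definition gauge_contractive {R : realType} {X : metricType R}
    (a : R) (f : R -> R) (T : X -> X) : Prop :=
  (forall t s : R, 0 < t -> t < s -> f t < f s) /\
  (forall x y : X, 0 < mdist (T x) (T y) ->
    a + f (mdist (T x) (T y)) <= f (mdist x y)).

Lemma Wardowski_gauge_contractive {R : realType} {X : metricType R}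
    (a : R) (F : R -> \bar R) (T : X -> X) :
  Wardowski_function F -> aF_contractive a F T ->
  gauge_contractive a (fine \o F) T.
Proof.
move=> [Fpoo Fnoo Fincr _] Tc.
have Ffin t : 0 < t -> F t \is a fin_num.
  move=> t0; rewrite fin_numE; apply/andP; split; apply/eqP.
    by move=> /(Fnoo _ (ltW t0)) t00; rewrite t00 ltxx in t0.
  exact/Fpoo/ltW.
split=> [t s t0 ts|x y Txy] /=.
  by rewrite -lte_fin !fineK ?Ffin ?(lt_trans t0 ts)// Fincr// ltW.
have xy : x <> y by move=> xy; rewrite xy mdistxx ltxx in Txy.
have dxy : 0 < mdist x y by rewrite mdist_gt0; apply/eqP.
by rewrite -lee_fin EFinD !fineK ?Ffin//; exact: Tc.
Qed.

Lemma gauge_Meir_Keeler {R : realType} {X : metricType R} (a : R) (f : R -> R)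
    (T : X -> X) :
  0 < a -> gauge_contractive a f T -> Meir_Keeler T.
Proof.
move=> a0 [fincr Tc] eps eps0.
pose S := f @` [set t | eps < t].
have Slb : has_lbound S.
  by exists (f eps) => _ [t /= epst <-]; apply/ltW/fincr.
have Sinf : has_inf S.
  by split => //; exists (f (eps + 1)), (eps + 1) => //=; rewrite ltrDl.
have [_ [t /= epst <-] ft] := inf_adherent a0 Sinf.
exists (t - eps); first by rewrite subr_gt0.
move=> x y; rewrite subrKC => dt; rewrite leNgt; apply/negP => epsd.
have Txy : 0 < mdist (T x) (T y) by exact: lt_trans epsd.
have dxy : 0 < mdist x y.
  by rewrite mdist_gt0; apply/eqP => xy; rewrite xy mdistxx ltxx in Txy.
have infS : inf S <= f (mdist (T x) (T y)).
  by apply: ge_inf => //; exists (mdist (T x) (T y)).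
have := Tc _ _ Txy; have := fincr _ _ dxy dt.
lra.
Qed.

Lemma gauge_small_steps {R : realType} {X : metricType R} (a : R) (f : R -> R)
    (T : X -> X) (x : X) :
  0 < a -> gauge_contractive a f T ->
  forall eps : R, 0 < eps -> exists N : nat, forall n : nat, (N <= n)%N ->
    mdist (iter n T x) (iter n.+1 T x) < eps.
Proof.
move=> a0 [fincr Tc] eps eps0.
pose d n := mdist (iter n T x) (iter n.+1 T x).
have fd n : 0 < d n -> n%:R * a + f (d n) <= f (d 0%N).
  elim: n => [|n IHn] dn0; first by rewrite mul0r add0r.
  have dn : 0 < d n.
    rewrite mdist_gt0; apply/eqP => xn.
    by move: dn0; rewrite /d (iterS n.+1) -xn -iterS -xn mdistxx ltxx.
  have := Tc _ _ dn0; rewrite -!iterS -/(d n) -/(d n.+1).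
  have := IHn dn; rewrite -natr1 mulrDl mul1r; lra.
pose N := Num.bound `|(f (d 0%N) - f eps) / a|.
exists N => n Nn; rewrite -/(d n) ltNge; apply/negP => epsd.
have feps : f eps <= f (d n).
  by move: epsd; rewrite le_eqVlt => /predU1P[<-|/(fincr _ _ eps0)/ltW]; rewrite ?lexx.
have Na : f (d 0%N) - f eps < n%:R * a.
  rewrite -ltr_pdivrMr//; apply: le_lt_trans (ler_norm _) _.
  by apply: lt_le_trans (archi_boundP (normr_ge0 _)) _; rewrite ler_nat.
have := fd n (lt_le_trans eps0 epsd).
lra.
Qed.

Theorem theorem3 (R : realType) (X : metricType R)
    (X_nonempty : [set: X] !=set0) (X_complete : complete_metric X)
    (T : X -> X) (a : R) (a_gt0 : 0 < a)
    (F : R -> \bar R) (F_Wardowski : Wardowski_function F)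
    (T_contractive : aF_contractive a F T) :
  globally_strong_Picard_operator T.
Proof.
have Tg := Wardowski_gauge_contractive _ _ _ F_Wardowski T_contractive.
have mkT := gauge_Meir_Keeler _ _ _ a_gt0 Tg.
have Tcauchy x : cauchy (iter n T x @[n --> \oo]).
  by apply: Meir_Keeler_cauchy => //; exact: gauge_small_steps Tg.
split; [split|].
- by move=> x; split=> //; exact: X_complete.
- by move=> x z; apply: nonexpansive_limit_fixed; exact: Meir_Keeler_nonexpansive.
- move=> x y Tx Ty; apply: contrapT => /eqP; rewrite -mdist_gt0 => dxy.
  have [_ /(_ x y)] := Tg.
  by rewrite Tx Ty => /(_ dxy); rewrite gerDr leNgt a_gt0.
Qed.
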